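(* For every hypergraph $H$, \[ \mathsf{subw}^{\mathrm{lift}}(H)\le \mathsf{subw}(H)\le \max\Bigl\{1,\tfrac32\,\mathsf{subw}^{\mathrm{lift}}(H)\Bigr\} \] and \[ \mathsf{adw}^{\mathrm{lift}}(H)\le \mathsf{adw}(H)\le \max\Bigl\{1,\tfrac32\,\mathsf{adw}^{\mathrm{lift}}(H)\Bigr\}. \]
   Context: Hypergraphs $H=(V,E)$ are finite, with $E\subseteq 2^V$, and have no isolated vertices (every vertex lies in some edge). For a set of sets $X$, $\bigcup X$ is the union of its members ($\bigcup\emptyset=\emptyset$). A function $b:2^V\to\mathbb R_{\ge0}$ is normalised if $b(\emptyset)=0$, monotone if $b(X)\le b(Y)$ for $X\subseteq Y$, submodular if $b(X)+b(Y)\ge b(X\cup Y)+b(X\cap Y)$ for all $X,Y$, and modular if $b(X)=\sum_{v\in X}w_v$ for some weights $w_v\ge 0$. Let $\mathbf 1\text{-}\mathsf{Sub}(H)$ (resp. $\mathbf 1\text{-}\mathsf{Mod}(H)$) be the set of normalised, monotone, submodular (resp. modular) functions $b:2^V\to\mathbb R_{\ge0}$ with $b(X)\le 1$ for all $e\in E$ and all $X\subseteq e$. A tree decomposition of $H$ is a pair $(T,B)$ with $T$ a tree and $B:V(T)\to 2^V$ such that every $e\in E$ is contained in some $B(u)$ and, for every $v\in V$, the set $\{u: v\in B(u)\}$ is nonempty and connected in $T$. Put $\tau_b(H):=\min_{(T,B)}\max_{u\in V(T)}b(B(u))$, and $\mathsf{subw}(H):=\sup_{b\in \mathbf 1\text{-}\mathsf{Sub}(H)}\tau_b(H)$,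 $\mathsf{adw}(H):=\sup_{b\in \mathbf 1\text{-}\mathsf{Mod}(H)}\tau_b(H)$. A branch decomposition of $E$ is a pair $(T,\delta)$ with $T$ a subcubic tree (all degrees $\le 3$) and $\delta$ a bijection from the leaves of $T$ onto $E$. Each $f\in E(T)$ induces a bipartition $(X_f,E\setminus X_f)$ of $E$ according to the two components of $T-f$. For $q:2^E\to\mathbb R_{\ge0}$ with $q(F)=q(E\setminus F)$ for all $F\subseteq E$, put $\mathfrak B_H(q):=\min_{(T,\delta)}\max_{f\in E(T)}q(X_f)$, with $\mathfrak B_H(q):=0$ if $|E|\le 1$. The boundary of $F\subseteq E$ is $\partial_H(F):=(\bigcup F)\cap(\bigcup(E\setminus F))$, and the boundary lift of $b$ is $\lambda_b(F):=b(\partial_H(F))$. Finally $\mathsf{subw}^{\mathrm{lift}}(H):=\sup\{\mathfrak B_H(\lambda_b): b\in \mathbf 1\text{-}\mathsf{Sub}(H)\}$ and $\mathsf{adw}^{\mathrm{lift}}(H):=\sup\{\mathfrak B_H(\lambda_b): b\in \mathbf 1\text{-}\mathsf{Mod}(H)\}$. *)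

(* Defs.v *)
(* MathComp / MathComp-Analysis; the reals are an arbitrary [R : realType]. *)
From mathcomp Require Import all_boot all_order all_algebra.
From mathcomp Require Import all_classical all_reals.

Set Implicit Arguments.
Unset Strict Implicit.
Unset Printing Implicit Defensive.

Import Order.TTheory GRing.Theory Num.Theory.
Local Open Scope ring_scope.

Record hypergraph := Hypergraph {
  vertex :> finType;
  edges : {set {set vertex}};
  no_isolated_vertex : forall v, exists2 e, e \in edges & v \in e }.

Section Graphs.
Variables (T : finType) (adj : rel T).

(* The subgraph induced by A is connected; the empty set counts as connected. *)
Definition connected_in (A : {set T}) : Prop :=
  {in A &, forall x y,
    connect [rel u v | [&& adj u v, u \in A & v \in A]] x y}.

(* [ucycle adj c] also holds for [:: x; y] when x and y are adjacent, so graph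
   cycles are those with at least three vertices. *)
Definition acyclic : Prop := forall c : seq T, ucycle adj c -> (size c <= 2)%N.

Definition degree (x : T) : nat := #|[set y | adj x y]%SET|.

Definition leaves : {set T} := [set x | degree x == 1%N]%SET.

(* Vertex set of the component of x after deleting the edge {x, y}. *)
Definition edge_component (x y : T) : {set T} :=
  [set z | connect [rel u v | adj u v && ([set u; v] != [set x; y])%SET] x z]%SET.

End Graphs.

Record tree := Tree {
  node :> finType;
  adj : rel node;
  adj_sym : symmetric adj;
  adj_irr : irreflexive adj;
  tree_nonempty : (0 < #|node|)%N;
  tree_connected : connected_in adj [set: node]%SET;
  tree_acyclic : acyclic adj }.

Record tree_decomposition (H : hypergraph) := TreeDecomposition {
  td_tree :> tree;
  bag : td_tree -> {set H};
  bag_edge : forall e, e \in edges H -> exists u, e \subset bag u;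
  bag_vertex : forall v : H, exists u, v \in bag u;
  bag_connected : forall v : H,
    connected_in (@adj td_tree) [set u | v \in bag u]%SET }.

(* [leaf_edge] is the bijection from the leaves onto E; its values at the other
   nodes are irrelevant. *)
Record branch_decomposition (H : hypergraph) := BranchDecomposition {
  bd_tree :> tree;
  leaf_edge : bd_tree -> {set H};
  bd_subcubic : forall x : bd_tree, (degree (@adj bd_tree) x <= 3)%N;
  leaf_edge_inj : {in leaves (@adj bd_tree) &, injective leaf_edge};
  leaf_edge_onto : [set leaf_edge x | x in leaves (@adj bd_tree)]%SET = edges H }.

(* The side X_f of the bipartition of E induced by the tree edge f = {x, y} that
   belongs to the component of x; [cut_side D y x] is the other side. *)
Definition cut_side (H : hypergraph) (D : branch_decomposition H) (x y : D) :
    {set {set H}} :=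
  [set leaf_edge z | z in leaves (@adj D) :&: edge_component (@adj D) x y]%SET.

Section Widths.
Variables (R : realType) (H : hypergraph).
Implicit Types (b : {set H} -> R) (q : {set {set H}} -> R).

Definition normalised b : Prop := b finset.set0 = 0.

Definition monotone b : Prop :=
  forall X Y : {set H}, X \subset Y -> b X <= b Y.

Definition submodular b : Prop :=
  forall X Y : {set H}, b (X :|: Y)%SET + b (X :&: Y)%SET <= b X + b Y.

Definition modular b : Prop :=
  exists2 w : H -> R, (forall v, 0 <= w v) &
    forall X : {set H}, b X = \sum_(v in X) w v.

Definition edge_dominated b : Prop :=
  forall e X : {set H}, e \in edges H -> X \subset e -> b X <= 1.

Definition oneSub : set ({set H} -> R) :=
  [set b | [/\ forall X, 0 <= b X, normalised b, monotone b, submodular b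
             & edge_dominated b]]%classic.

Definition oneMod : set ({set H} -> R) :=
  [set b | [/\ forall X, 0 <= b X, normalised b, monotone b, modular b
             & edge_dominated b]]%classic.

(* The maxima below start from 0, which is harmless for nonnegative functions.
   The infima are minima: their sets are nonempty and contain only finitely
   many values. *)
Definition tau b : R :=
  inf [set r | exists D : tree_decomposition H,
    r = \big[Num.max/0]_(u : D) b (bag u)]%classic.

(* Each tree edge is counted with both of its sides, which have the same value
   under the symmetric functions q considered here. *)
Definition branch_width q : R :=
  if (#|edges H| <= 1)%N then 0 else
  inf [set r | exists D : branch_decomposition H,
    r = \big[Num.max/0]_(f : D * D | adj f.1 f.2) q (cut_side f.1 f.2)]%classic.

Definition boundary (F : {set {set H}}) : {set H} :=
  (finset.cover F :&: finset.cover (edges H :\: F))%SET.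

Definition boundary_lift b : {set {set H}} -> R := fun F => b (boundary F).

End Widths.

(* The suprema are over nonempty sets (b = 0 is allowed) that are bounded above:
   since E covers V, b X <= b V <= #|E| for every admissible b. *)
Definition subw (R : realType) (H : hypergraph) : R :=
  sup [set tau b | b in @oneSub R H]%classic.

Definition adw (R : realType) (H : hypergraph) : R :=
  sup [set tau b | b in @oneMod R H]%classic.

Definition subw_lift (R : realType) (H : hypergraph) : R :=
  sup [set branch_width (boundary_lift b) | b in @oneSub R H]%classic.

Definition adw_lift (R : realType) (H : hypergraph) : R :=
  sup [set branch_width (boundary_lift b) | b in @oneMod R H]%classic.

(* Main.v *)
(* The inequalities hold for each b separately:
   branch_width (boundary_lift b) <= tau b <= max(1, 3/2 branch_width (boundary_lift b)).

   Left: host each hyperedge at a node whose bag contains it. Pruning pendant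
   nodes of the tree one by one, and pairing up sets of hyperedges hosted at the
   same node, assembles a rooted binary tree of sets of hyperedges each of whose
   boundaries lies in a bag; monotonicity of b suffices.

   Right: on the tree of a branch decomposition, let the bag of u collect the
   vertices v such that u lies on a path between two leaves whose hyperedges
   contain v. At a leaf this is the hyperedge itself. At an inner node every
   element of the bag lies in at least two of the at most three boundaries
   around u, so submodularity gives 2 b(bag) <= b(A1) + b(A2) + b(A3). *)
Require Import Defs.
From mathcomp Require Import all_boot all_order all_algebra.
From mathcomp Require Import all_classical all_reals.
From mathcomp Require Import lra.
From mathcomp Require Import fintype finset.

Set Implicit Arguments.
Unset Strict Implicit.
Unset Printing Implicit Defensive.

Import Order.TTheory GRing.Theory Num.Theory.
Local Open Scope ring_scope.

(** * Bridges and pendant vertices in acyclic graphs *)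

Section Trees.

(** A walk from [x] to [y] avoiding this edge shortens to a simple path with at least two edges,
    which the edge closes to a forbidden cycle. *)
Lemma edge_bridge (T : tree) (x y : T) :
  adj x y -> y \notin edge_component (@adj T) x y.
Proof.
move=> xy; rewrite inE; apply/negP => /connectP[p px].
case: (shortenP px) => q qx uq _ yE.
have qadj : path (@adj T) x q by apply: sub_path qx => a b /andP[].
case: q => [|a [|c q]] in qx uq yE qadj.
- by rewrite /= in yE; rewrite yE adj_irr in xy.
- by rewrite /= in yE qx; rewrite -yE eqxx andbF in qx.
have cyc : cycle (@adj T) (x :: a :: c :: q).
  by rewrite [cycle _ _]rcons_path qadj -yE adj_sym.
have := @tree_acyclic T (x :: a :: c :: q).
by rewrite /ucycle cyc uq => /(_ isT).
Qed.

(* The end of a maximal path inside S is pendant in S. *)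
Lemma acyclic_pendant (T : finType) (e : rel T) (S : {set T}) :
    symmetric e -> irreflexive e -> acyclic e -> S != set0 ->
  exists2 x, x \in S & {in S &, forall y z, e x y -> e x z -> y = z}.
Proof.
move=> esym eirr eacyc /set0Pn[x0 x0S].
(* The path is listed backwards from its current end [x], so it grows at the head; [n] bounds the
   extensions left, as a simple path has at most [#|T|] vertices. *)
suff main n x p : path e x p -> uniq (x :: p) -> {subset x :: p <= S} ->
    (#|T| <= n + size p)%N ->
    exists2 x, x \in S & {in S &, forall y z, e x y -> e x z -> y = z}.
  apply: (main #|T| x0 [::]) => //; last by rewrite addn0.
  by move=> z; rewrite inE => /eqP->.
elim: n x p => [|n IHn] x p ep up pS nT.
  by have := max_card [in x :: p]; rewrite (card_uniqP up) leqNgt ltnS nT.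
have [/existsP[y /and3P[yS xy yp]]|noext] :=
    boolP [exists y, [&& y \in S, e x y & y \notin x :: p]].
  apply: (IHn y (x :: p)); rewrite /= ?addnS -?addSn //.
  - by rewrite esym xy.
  - by rewrite yp.
  - by move=> z; rewrite inE => /predU1P[->//|]; apply: pS.
(* When no extension exists, a neighbour of [x] in [S] lies on the path, and any but the preceding
   vertex would close a cycle of length at least three. *)
have hd y : y \in S -> e x y -> y = head x p.
  move=> yS xy; have : y \in x :: p.
    by apply: contraNT noext => yp; apply/existsP; exists y; rewrite yS xy.
  rewrite inE => /predU1P[yx|yp]; first by rewrite yx eirr in xy.
  case/splitPr: yp ep up {pS nT noext} => -[//|a p1] p2.
  rewrite -cat_rcons cat_path -cat_cons cat_uniq => /andP[ep _] /and3P[up _ _].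
  have /eacyc : ucycle e (x :: rcons (a :: p1) y).
    by apply/andP; rewrite up [cycle _ _]rcons_path ep last_rcons esym.
  by rewrite /= size_rcons.
exists x; first by apply: pS; rewrite mem_head.
by move=> y z yS zS xy xz; rewrite (hd y) // (hd z).
Qed.

End Trees.

(* Nested pairs of disjoint sets encode a binary tree with leaves [set a],
   a \in F, all of whose nodes satisfy P. *)
Definition binary_laminar (A : finType) (P : pred {set A}) (F : {set A})
    (L : {set {set A}}) : Prop :=
  [/\ F \in L,
      {in L, forall G : {set A}, [/\ G != set0, G \subset F & P G]},
      {in L &, forall G K : {set A}, [|| G \subset K, K \subset G | [disjoint G & K]]},
      {in F, forall a, [set a] \in L}
    & {in L, forall G : {set A}, #|G| = 1%N \/
        exists G1 G2, [/\ G1 \in L, G2 \in L, [disjoint G1 & G2]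
                        & G = G1 :|: G2]}].

(** * Building binary laminar families by disjoint unions *)

Section BinaryLaminar.
Variables (A : finType) (P : pred {set A}).
Implicit Types (F G : {set A}) (L : {set {set A}}).

Lemma binary_laminar1 a : P [set a] -> binary_laminar P [set a] [set [set a]].
Proof.
move=> Pa; split=> [|G|G K|x|G]; rewrite ?set11 // !inE.
- by move/eqP->; split=> //; apply/set0Pn; exists a; rewrite set11.
- by move=> /eqP-> /eqP->; rewrite subxx.
- by move/eqP->.
- by move/eqP->; left; rewrite cards1.
Qed.

Lemma binary_laminarU F1 F2 L1 L2 :
    binary_laminar P F1 L1 -> binary_laminar P F2 L2 ->
    [disjoint F1 & F2] -> P (F1 :|: F2) ->
  binary_laminar P (F1 :|: F2) ((F1 :|: F2) |: (L1 :|: L2)).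
Proof.
move=> [F1L L1P lam1 sing1 bin1] [F2L L2P lam2 sing2 bin2] dF PF.
have sub G : G \in (F1 :|: F2) |: (L1 :|: L2) -> G \subset F1 :|: F2.
  rewrite !inE => /or3P[/eqP->//|/L1P[_ GF _]|/L2P[_ GF _]];
    by apply: (subset_trans GF); rewrite (subsetUl, subsetUr).
have dL G K : G \in L1 -> K \in L2 -> [disjoint G & K].
  move=> /L1P[_ GF _] /L2P[_ KF _].
  by apply: (disjointWl GF); apply: (disjointWr KF).
split.
- by rewrite setU11.
- move=> G GL; have GF := sub G GL; move: GL; rewrite !inE.
  case/or3P=> [/eqP E|/L1P[G0 _ PG]|/L2P[G0 _ PG]]; split=> //; rewrite E //.
  by have [/set0Pn[x xF] _ _] := L1P _ F1L; apply/set0Pn; exists x; rewrite inE xF.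
- move=> G K GL KL; have [GF KF] := (sub G GL, sub K KL); move: GL KL; rewrite !inE.
  case/or3P=> [/eqP->|GL|GL]; first by rewrite KF orbT.
    case/or3P=> [/eqP->|KL|KL]; [by rewrite GF | exact: lam1 |].
    by rewrite dL ?orbT.
  case/or3P=> [/eqP->|KL|KL]; [by rewrite GF | | exact: lam2].
  by rewrite disjoint_sym dL ?orbT.
- move=> a; rewrite !inE => /orP[/sing1->|/sing2->]; by rewrite ?orbT.
move=> G; rewrite !inE => /or3P[/eqP->|/bin1[|[G1 [G2 [G1L G2L dG ->]]]]|/bin2[|[G1 [G2 [G1L G2L dG ->]]]]]; try by left.
- by right; exists F1, F2; rewrite !inE F1L F2L !orbT.
- by right; exists G1, G2; rewrite !inE G1L G2L !orbT.
- by right; exists G1, G2; rewrite !inE G1L G2L !orbT.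
Qed.

(** Members of a laminar family are nonempty, whereas a node of a tree decomposition may host no
    hyperedge; hence the first disjunct. *)
Definition laminarizable F : Prop := F = set0 \/ exists L, binary_laminar P F L.

Lemma laminarizableU F1 F2 :
    laminarizable F1 -> laminarizable F2 -> [disjoint F1 & F2] ->
  P (F1 :|: F2) -> laminarizable (F1 :|: F2).
Proof.
case=> [->|[L1 H1]]; first by rewrite set0U.
case=> [->|[L2 H2]]; first by rewrite setU0 => _ _; right; exists L1.
by move=> dF PF; right; exists ((F1 :|: F2) |: (L1 :|: L2)); apply: binary_laminarU.
Qed.

(** Splitting off one element at a time gives a caterpillar all of whose nodes are subsets of
    [F]. *)
Lemma hereditary_laminarizable F :
  (forall G, G \subset F -> P G) -> laminarizable F.
Proof.
have [n] := ubnP #|F|; elim: n F => // n IHn F; rewrite ltnS => Fn PF.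
have [->|/set0Pn[a aF]] := eqVneq F set0; first by left.
rewrite -(setD1K aF); apply: laminarizableU.
- right; exists [set [set a]]; apply: binary_laminar1.
  by apply: PF; rewrite sub1set.
- apply: IHn; first by rewrite (cardsD1 a F) aF in Fn.
  by move=> G /subset_trans GF; apply/PF/GF/subsetDl.
- by rewrite disjoints1 !inE eqxx.
- by rewrite setD1K //; apply: PF.
Qed.

End BinaryLaminar.

(** * Boundaries of sets of hyperedges *)

Section Boundary.
Variable H : hypergraph.
Implicit Types (F G : {set {set H}}) (v : H).

Lemma boundaryP F v : reflect
  ((exists2 e, e \in F & v \in e) /\
   (exists2 e, (e \in edges H) && (e \notin F) & v \in e))
  (v \in boundary F).
Proof.
apply: (iffP setIP) => [[/bigcupP[e eF ve] /bigcupP[e']]|[[e eF ve] [e']]].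
  by rewrite inE andbC => e'F ve'; split; [exists e | exists e'].
rewrite andbC => e'F ve'; split; apply/bigcupP; first by exists e.
by exists e'; rewrite ?inE.
Qed.

Lemma boundaryU F G : boundary (F :|: G) \subset boundary F :|: boundary G.
Proof.
apply/subsetP => v /boundaryP[[e eFG ve] [e' /andP[e'E]]].
rewrite inE negb_or => /andP[e'F e'G] ve'; rewrite inE.
case/setUP: eFG => [eF|eG]; apply/orP; [left|right]; apply/boundaryP; split;
  by [exists e | exists e'; rewrite ?e'E].
Qed.

Lemma boundaryC F : F \subset edges H -> boundary (edges H :\: F) = boundary F.
Proof. by move=> FE; rewrite /boundary setDDr setDv set0U (setIidPr FE) setIC. Qed.

End Boundary.

(** * From a tree decomposition to a laminar family *)

Section Elimination.

(** A simple path through [x] with both ends elsewhere would enter and leave [x] by two distinct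
    neighbours in [A]. *)
Lemma connected_in_pendant (T : finType) (e : rel T) (A : {set T}) (x : T) :
    symmetric e -> {in A &, forall y z, e x y -> e x z -> y = z} ->
  connected_in e A -> connected_in e (A :\ x).
Proof.
move=> esym xpend conA a b /setD1P[ax aA] /setD1P[bx bA].
have /connectP[p pA bE] := conA a b aA bA.
case: (shortenP pA) bE => q qA uq _ bE.
suff xq : x \notin a :: q.
  apply/connectP; exists q => //.
  elim: q a {ax aA uq bE pA} qA xq => //= c q IHq a /andP[/and3P[ac aA cA] qA].
  rewrite !inE !negb_or => /and3P[xa xc xq].
  by rewrite ac aA cA eq_sym xa eq_sym xc /= IHq // inE negb_or xc.
rewrite inE negb_or eq_sym ax /=; apply/negP => xq.
case/splitPr: xq qA uq bE => q1 [|c q2].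
  by rewrite last_cat /= => _ _ bE; rewrite bE eqxx in bx.
rewrite -cat_cons cat_uniq cat_path => qA /and3P[_ /hasPn dis _] _.
have /and4P[_ /and3P[lx lA _] /and3P[xc _ cA] _] := qA.
rewrite esym in lx; have cE := xpend _ _ cA lA xc lx.
have /dis : c \in x :: c :: q2 by rewrite !inE eqxx orbT.
by rewrite cE mem_last.
Qed.

Variables (H : hypergraph) (D : tree_decomposition H).

Let in_bag : pred {set {set H}} :=
  [pred F | [exists u : D, boundary F \subset bag u]].

Let fiber (u : {set H} -> D) (x : D) := [set e in edges H | u e == x].

(* Pendant nodes of S are removed one at a time, the edges hosted by such a node
   being moved to its neighbour; an edge e is hosted by the node [u e]. *)
Lemma elimination n (S : {set D}) (u : {set H} -> D) :
    (#|S| <= n)%N -> {in edges H, forall e, u e \in S} ->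
    {in S, forall x, laminarizable in_bag (fiber u x) /\
                     boundary (fiber u x) \subset bag x} ->
    (forall v : H, connected_in (@adj D) (S :&: [set x | v \in bag x])) ->
  laminarizable in_bag (edges H).
Proof.
elim: n S u => [|n IHn] S u.
  rewrite leqn0 cards_eq0 => /eqP-> uS _ _; left; apply/eqP.
  by apply/negPn/negP => /set0Pn[e /uS]; rewrite inE.
move=> Sn uS fibS conS.
have [S0|S0] := eqVneq S set0.
  by apply: (IHn S u) => //; rewrite S0 cards0.
have [x xS xpend] := acyclic_pendant (@adj_sym D) (@adj_irr D)
  (@tree_acyclic D) S0.
have [Sx|/set0Pn[y0 y0S]] := eqVneq (S :\ x) set0.
  suff -> : edges H = fiber u x by have [] := fibS x xS.
  apply/setP => e; rewrite inE; case eE: (e \in edges H) => //=.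
  apply/esym/negPn/negP => uex.
  by have := in_set0 (u e); rewrite -Sx !inE uex uS.
(* If [x] has no neighbour in [S], the condition on [y] is vacuous and any other node of [S] will
   do. *)
have [y yS ynb] : exists2 y, y \in S :\ x & {in S, forall z, adj x z -> z = y}.
  have [/existsP[y /andP[yS xy]]|no] := boolP [exists y, (y \in S) && adj x y].
    exists y; last by move=> z zS xz; apply: xpend.
    by rewrite !inE yS andbT; apply: contraTneq xy => ->; rewrite adj_irr.
  exists y0 => // z zS xz; case/negP: no; apply/existsP; exists z.
  by rewrite zS.
have [yx yS'] := setD1P yS.
(* The nodes of [S] whose bags contain [v] are connected, so a walk from [x] to [z] among them
   starts with the step to [y]. *)
have to_y v z : v \in bag x -> z \in S :\ x -> v \in bag z -> v \in bag y.
  move=> vx /setD1P[zx zS] vz.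
  have mem w : w \in S -> v \in bag w -> w \in S :&: [set x | v \in bag x].
    by move=> wS vw; rewrite !inE wS.
  have /connectP[[|a p] /=] := conS v x z (mem _ xS vx) (mem _ zS vz).
    by move=> _ zE; rewrite zE eqxx in zx.
  rewrite !inE => /andP[/and3P[xa _ /andP[aS va]] _] _.
  by rewrite -(ynb a aS xa).
(* A boundary vertex also lies in a hyperedge hosted at another node, hence in the boundary of that
   node's fiber and in its bag; [to_y] then applies. *)
have bdy : boundary (fiber u x) \subset bag y.
  apply/subsetP => v vF; have [_ /subsetP fx] := fibS x xS.
  have /boundaryP[[e eF ve] [e' /andP[e'E e'F] ve']] := vF.
  have ue'x : u e' != x by rewrite inE e'E in e'F.
  apply: (to_y v (u e')); first exact: fx.
    by rewrite !inE ue'x uS.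
  have [_ /subsetP fe'] := fibS (u e') (uS _ e'E).
  apply: fe'; apply/boundaryP; split; first by exists e'; rewrite // inE e'E eqxx.
  exists e => //; move: eF; rewrite !inE => /andP[-> /eqP->] /=.
  by rewrite eq_sym.
pose u' e := if u e == x then y else u e.
have fiby : fiber u' y = fiber u x :|: fiber u y.
  apply/setP => e; rewrite !inE -andb_orr /u'.
  by case: (u e == x); rewrite ?eqxx.
have fibz z : z != x -> z != y -> fiber u' z = fiber u z.
  move=> zx zy; apply/setP => e; rewrite !inE /u'.
  have [->|//] := eqVneq (u e) x.
  by rewrite eq_sym (negPf zy) eq_sym (negPf zx).
apply: (IHn (S :\ x) u').
- by rewrite (cardsD1 x S) xS in Sn.
- move=> e eE; rewrite /u'; case: ifP => [//|/negbT uex].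
  by rewrite !inE uex uS.
- move=> z zS; have [zx zS'] := setD1P zS.
  have [->|zy] := eqVneq z y; last by rewrite fibz //; apply: fibS.
  have [[lx _] [ly by_]] := (fibS x xS, fibS y yS').
  have by' : boundary (fiber u' y) \subset bag y.
    by rewrite fiby; apply: subset_trans (boundaryU _ _) _; rewrite subUset bdy.
  split=> //; rewrite fiby; apply: laminarizableU => //.
    rewrite -setI_eq0; apply/eqP/setP => e; rewrite !inE.
    by case: eqP => [->|]; rewrite ?andbF // eq_sym (negPf yx) !andbF.
  by rewrite -fiby; apply/existsP; exists y.
move=> v; have -> : (S :\ x) :&: [set x0 | v \in bag x0] =
    (S :&: [set x0 | v \in bag x0]) :\ x.
  by apply/setP => z; rewrite !inE andbA.
apply: connected_in_pendant (conS v); first exact: adj_sym.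
by move=> a c /setIP[aS _] /setIP[cS _]; apply: xpend.
Qed.

(** Initially every set of hyperedges hosted at one node has its boundary in that bag, so each fiber
    is laminarizable by heredity and elimination can start from the whole tree. *)
Lemma tree_decomposition_laminar : laminarizable in_bag (edges H).
Proof.
have [u0 _] : exists u : D, true.
  by have /card_gt0P[u _] := tree_nonempty D; exists u.
pose u (e : {set H}) := odflt u0 [pick x : D | e \subset bag x].
have ubag e : e \in edges H -> e \subset bag (u e).
  move=> eE; rewrite /u; case: pickP => //= no.
  by have [x] := bag_edge D eE; rewrite no.
have sub x (G : {set {set H}}) : G \subset fiber u x -> boundary G \subset bag x.
  move=> /subsetP GF; apply/subsetP => v /boundaryP[[e /GF]].
  by rewrite inE => /andP[/ubag/subsetP eu /eqP<-] /eu.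
apply: (@elimination #|[set: D]| setT u) => //.
- by move=> x _; split; [apply: hereditary_laminarizable => G GF;
    apply/existsP; exists x |]; apply: sub.
- by move=> v; rewrite setTI; apply: bag_connected.
Qed.

End Elimination.

(** * Trees given by parent pointers *)

Section ParentTree.
Variables (T : finType) (r : T) (par : T -> T) (rk : T -> nat).
Hypothesis par_root : par r = r.
Hypothesis rk_par : forall x, x != r -> (rk (par x) < rk x)%N.

(** The first conjunct removes the loop at [r], which is its own parent. *)
Definition parent_adj (x y : T) : bool :=
  (x != y) && ((par x == y) || (par y == x)).

Lemma parent_adj_sym : symmetric parent_adj.
Proof. by move=> x y; rewrite /parent_adj eq_sym orbC. Qed.

Lemma parent_adj_irr : irreflexive parent_adj.
Proof. by move=> x; rewrite /parent_adj eqxx. Qed.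

Lemma parent_adj_par x : x != r -> parent_adj x (par x).
Proof.
move=> xr; rewrite /parent_adj eqxx andbT.
by apply/eqP => xE; have := rk_par xr; rewrite -xE ltnn.
Qed.

Lemma parent_adj_rk x y : parent_adj x y -> (rk y <= rk x)%N -> y = par x.
Proof.
case/andP=> xy /orP[/eqP->//|/eqP yx]; have [yr|yr] := eqVneq y r.
  by rewrite yr par_root in yx; rewrite -yx yr eqxx in xy.
by move=> le; have := rk_par yr; rewrite yx ltnNge le.
Qed.

Lemma parent_adjP x y : parent_adj x y ->
  (x != r /\ par x = y) \/ (y != r /\ par y = x).
Proof.
case/andP=> xy /orP[/eqP E|/eqP E]; [left|right]; split=> //.
  by apply: contraNneq xy => xr; rewrite -E xr par_root.
by apply: contraNneq xy => yr; rewrite -E yr par_root.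
Qed.

Lemma parent_connected : connected_in parent_adj [set: T].
Proof.
have root x : connect [rel u v | [&& parent_adj u v, u \in [set: T]
    & v \in [set: T]]] x r.
  have [n] := ubnP (rk x); elim: n x => // n IHn x xn.
  have [->|xr] := eqVneq x r; first exact: connect0.
  apply: connect_trans (IHn (par x) (leq_trans (rk_par xr) xn)).
  by apply: connect1; rewrite /= !inE !andbT; apply: parent_adj_par.
move=> x y _ _; apply: connect_trans (root x) _.
rewrite sym_connect_sym // => a b.
by rewrite /= !inE !andbT; apply: parent_adj_sym.
Qed.

(* Both neighbours in a cycle of a vertex of maximal rank are its parent. *)
Lemma parent_acyclic : acyclic parent_adj.
Proof.
move=> c /andP[cyc uc]; rewrite leqNgt; apply/negP => c3.
have [x xc xmax] : exists2 x, x \in c & {in c, forall y, rk y <= rk x}%N.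
  case: c c3 {cyc uc} => // a c _.
  have ac : a \in a :: c by rewrite mem_head.
  case: (arg_maxnP (P := [in a :: c]) rk ac) => x xc xmax.
  by exists x => // y; apply: xmax.
have [i c' rotE] := rot_to xc.
rewrite -(rot_cycle i) rotE in cyc; rewrite -(rot_uniq i) rotE in uc.
rewrite -(size_rot i) rotE in c3.
have {}xmax y : y \in c' -> (rk y <= rk x)%N.
  by move=> yc; apply: xmax; rewrite -(mem_rot i) rotE inE yc orbT.
case: c' => [|y c'] // in rotE cyc uc c3 xmax.
case/lastP: c' => [//|c' z] in rotE cyc uc c3 xmax.
move: cyc; rewrite /cycle -rcons_cons rcons_path last_rcons => /andP[/andP[xy _] zx].
rewrite -/(parent_adj x y) in xy; rewrite -/(parent_adj z x) parent_adj_sym in zx.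
have yE : y = par x by apply: parent_adj_rk xy _; apply: xmax; rewrite mem_head.
have zE : z = par x.
  by apply: parent_adj_rk zx _; apply: xmax; rewrite inE mem_rcons mem_head orbT.
by move: uc; rewrite yE -zE /= mem_rcons mem_head andbF.
Qed.

Lemma parent_nonempty : (0 < #|T|)%N.
Proof. by apply/card_gt0P; exists r. Qed.

Definition parent_tree : tree :=
  Tree parent_adj_sym parent_adj_irr parent_nonempty parent_connected
    parent_acyclic.

End ParentTree.

(** * The branch decomposition tree of a binary laminar family *)

Section LaminarTree.
Variables (A : finType) (P : pred {set A}) (F : {set A}) (L : {set {set A}}).
Hypothesis lamL : binary_laminar P F L.
Hypothesis F_gt1 : (1 < #|F|)%N.

Let N : finType := {G : {set A} | G \in L}.

Lemma laminar_root : F \in L. Proof. by case: lamL. Qed.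

Let root : N := exist _ F laminar_root.

Lemma laminar_nodeP (x : N) : [/\ val x != set0, val x \subset F & P (val x)].
Proof. by case: lamL => _ h _ _ _; apply/h/valP. Qed.

Lemma laminar_cmp (x y : N) (a : A) : a \in val x -> a \in val y ->
  (val x \subset val y) || (val y \subset val x).
Proof.
case: lamL => _ _ h _ _ ax ay; have := h _ _ (valP x) (valP y).
case/or3P=> [->|->|/disjointFr/(_ ax)] //; rewrite ?orbT //.
by rewrite ay.
Qed.

(** The search fails only at the root, which the default makes its own parent, as [parent_tree]
    requires. *)
Definition laminar_parent (x : N) : N :=
  odflt root [pick y : N | (val x \proper val y) &&
    [forall z : N, (val x \proper val z) ==> (val y \subset val z)]].

(** Strict supersets of [x] in [L] share an element and are thus comparable, so one of minimum
    cardinality is the least. *)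
Lemma laminar_parentP (x : N) : x != root ->
  val x \proper val (laminar_parent x) /\
  (forall z : N, val x \proper val z -> val (laminar_parent x) \subset val z).
Proof.
move=> xr; rewrite /laminar_parent; case: pickP => /= [y /andP[xy /forallP h]|no].
  by split=> // z; apply/implyP.
have [/set0Pn[a ax] xF _] := laminar_nodeP x.
have xroot : val x \proper val root.
  by rewrite properEneq xF andbT; apply: contraNneq xr => E; apply/eqP/val_inj.
have [y xy ymin] := @arg_minnP N root (fun y => val x \proper val y)
  (fun y => #|val y|) xroot.
have /idP[] := no y; rewrite xy /=; apply/forallP => z; apply/implyP => xz.
have [ay az] : a \in val y /\ a \in val z.
  by split; apply: (subsetP (proper_sub _)) ax.
case/orP: (laminar_cmp ay az) => // zy.
by have /eqP <- : val z == val y by rewrite eqEcard zy ymin.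
Qed.

Lemma laminar_parent_root : laminar_parent root = root.
Proof.
rewrite /laminar_parent; case: pickP => //= y /andP[/proper_sub Fy _].
apply: val_inj; apply/eqP; rewrite eqEsubset Fy andbT.
by have [] := laminar_nodeP y.
Qed.

Let rk (x : N) : nat := #|F| - #|val x|.

Lemma laminar_rk x : x != root -> (rk (laminar_parent x) < rk x)%N.
Proof.
move=> xr; have [xy _] := laminar_parentP xr.
have [_ yF _] := laminar_nodeP (laminar_parent x).
apply: ltn_sub2l; last exact: proper_card.
by apply: leq_trans (proper_card xy) (subset_leq_card yF).
Qed.

Definition laminar_tree : tree := parent_tree laminar_parent_root laminar_rk.

Let adjL : rel N := parent_adj laminar_parent.

Lemma laminar_adjP (x y : N) : adjL x y ->
  (x != root /\ laminar_parent x = y) \/ (y != root /\ laminar_parent y = x).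
Proof.
exact: (parent_adjP laminar_parent_root).
Qed.

(** The parent of one half lies inside [x] and meets the other half. It cannot lie within that half,
    so it contains both and equals [x]. *)
Lemma laminar_split (x : N) : (#|val x| != 1)%N -> exists x1 x2 : N,
  [/\ [disjoint (val x1) & (val x2)], val x = val x1 :|: val x2,
      x1 != root /\ laminar_parent x1 = x & x2 != root /\ laminar_parent x2 = x].
Proof.
move=> x1; have /(_ _ (valP x)) := let: And5 _ _ _ _ h := lamL in h.
case=> [/eqP|]; first by rewrite (negPf x1).
move=> [G1 [G2 [G1L G2L dG xE]]].
pose y1 : N := exist _ G1 G1L; pose y2 : N := exist _ G2 G2L.
have main (z1 z2 : N) : [disjoint (val z1) & (val z2)] -> val x = val z1 :|: val z2 ->
    z1 != root /\ laminar_parent z1 = x.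
  move=> dz E; have [/set0Pn[a1 az1] _ _] := laminar_nodeP z1.
  have [/set0Pn[a2 az2] z2F _] := laminar_nodeP z2.
  have zr : z1 != root.
    apply/negP => /eqP zr; have := disjointFl dz az2.
    by rewrite zr (subsetP z2F).
  split=> //; have [zp zmin] := laminar_parentP zr.
  have zx : val z1 \proper val x.
    rewrite E properE subsetUl; apply/negP => /subsetP/(_ a2).
    by rewrite inE az2 orbT => /(_ isT); rewrite (disjointFl dz).
  apply/val_inj/eqP; rewrite eqEsubset zmin //= E subUset (proper_sub zp) /=.
  have [z1p [a ap az]] := properP zp.
  have az2' : a \in val z2.
    by have := subsetP (zmin x zx) a ap; rewrite E inE (negPf az).
  case/orP: (laminar_cmp ap az2') => // /subsetP pz.
  by have := disjointFr dz az1; rewrite pz // (subsetP z1p).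
exists y1, y2; split=> //; first exact: (main y1 y2).
by apply: (main y2 y1); rewrite /= 1?disjoint_sym 1?setUC.
Qed.

(** A child of [x] meets [x1] or [x2]. Distinct children that meet would be nested, one lying
    strictly between the other and its parent [x]. *)
Lemma laminar_child (x x1 x2 y : N) :
    val x = val x1 :|: val x2 ->
    x1 != root /\ laminar_parent x1 = x -> x2 != root /\ laminar_parent x2 = x ->
    y != root -> laminar_parent y = x -> y = x1 \/ y = x2.
Proof.
move=> xE [r1 p1] [r2 p2] ry py.
have [yx ymin] := laminar_parentP ry; rewrite py in yx ymin.
have main (z : N) (a : A) : z != root -> laminar_parent z = x ->
    a \in val y -> a \in val z -> y = z.
  move=> rz pz ay az; have [zx zmin] := laminar_parentP rz; rewrite pz in zx zmin.
  apply/val_inj/eqP; apply/negPn/negP => yz.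
  case/orP: (laminar_cmp ay az) => le.
    have /ymin xz : val y \proper val z by rewrite properEneq yz.
    by have := proper_subn zx; rewrite xz.
  have /zmin xy : val z \proper val y by rewrite properEneq eq_sym yz.
  by have := proper_subn yx; rewrite xy.
have [/set0Pn[a ay] _ _] := laminar_nodeP y.
have := subsetP (proper_sub yx) a ay; rewrite xE inE => /orP[a1|a2].
  by left; apply: (main x1 a).
by right; apply: (main x2 a).
Qed.

Lemma laminar_parent_adj (x : N) : x != root -> adjL x (laminar_parent x).
Proof. exact: (parent_adj_par laminar_rk). Qed.

Lemma laminar_adj_sym : symmetric adjL.
Proof. exact: parent_adj_sym. Qed.

(** This is where [F_gt1] enters: for a single element the root would be an isolated node, hence not
    a leaf. *)
Lemma laminar_neq_root (x : N) : #|val x| = 1%N -> x != root.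
Proof. by move=> x1; apply/eqP => xr; have := F_gt1; rewrite -x1 xr ltnn. Qed.

Lemma laminar_degree1 (x : N) : #|val x| = 1%N -> degree adjL x = 1%N.
Proof.
move=> x1; have xr := laminar_neq_root x1.
rewrite /degree -(cards1 (laminar_parent x)); congr #|pred_of_set _|.
apply/setP => y; rewrite !inE; apply/idP/eqP => [|->]; last exact: laminar_parent_adj.
case/laminar_adjP=> [[_ ->]//|[yr yx]].
have [/proper_card] := laminar_parentP yr; rewrite yx x1 ltnS leqn0 cards_eq0.
by have [/negPf-> _ _] := laminar_nodeP y.
Qed.

(** The two children give the lower bound, which keeps inner nodes from being leaves; the parent is
    the only other possible neighbour. *)
Lemma laminar_degree (x : N) : #|val x| != 1%N -> (1 < degree adjL x <= 3)%N.
Proof.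
case/laminar_split=> x1 [x2 [dx xE X1 X2]]; apply/andP; split.
  have x12 : x1 != x2.
    apply/eqP => E; have [/set0Pn[a ax] _ _] := laminar_nodeP x1.
    by have := disjointFr dx ax; rewrite -E ax.
  have <- : #|[set x1; x2]| = 2%N by rewrite cards2 x12.
  apply/subset_leq_card/subsetP => y; rewrite !inE laminar_adj_sym.
  by case/orP=> /eqP->; [case: X1 | case: X2] => r p; have := laminar_parent_adj r; rewrite p.
apply: (@leq_trans #|[set laminar_parent x; x1; x2]|).
  apply/subset_leq_card/subsetP => y; rewrite !inE.
  case/laminar_adjP=> [[_ ->]|[yr yx]]; first by rewrite eqxx.
  by case: (laminar_child xE X1 X2 yr yx) => ->; rewrite eqxx ?orbT.
rewrite -setUA; apply: leq_trans (leq_card_setU _ _).1 _.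
by rewrite cards1 cards2; case: eqP.
Qed.

Lemma laminar_leaf (x : N) : (x \in leaves adjL) = (#|val x| == 1%N).
Proof.
rewrite inE; apply/idP/idP => [d1|/eqP/laminar_degree1->//].
by apply/negPn/negP => /laminar_degree; rewrite (eqP d1).
Qed.

Let avoids (x : N) : rel N :=
  [rel u v | adjL u v && ([set u; v] != [set x; laminar_parent x])].

Lemma avoids_sym (x : N) : symmetric (avoids x).
Proof. by move=> a b; rewrite /avoids /= laminar_adj_sym setUC. Qed.

(** Steps down shrink the set, and a step up from a proper subset of [x] stays below [x] because the
    parent is the least strict superset. Only the deleted edge leads out of [x]. *)
Lemma avoids_subset (x a b : N) : avoids x a b ->
  (val a \subset val x) = (val b \subset val x).
Proof.
have half (c d : N) : avoids x c d -> val c \subset val x -> val d \subset val x.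
  case/andP=> /laminar_adjP[[cr <-]|[dr <-]] cx sub; last first.
    by have [/proper_sub/subset_trans->] := laminar_parentP dr.
  have [_ ->//] := laminar_parentP cr.
  by rewrite properEneq sub andbT; apply: contraNneq cx => /val_inj->.
move=> ab; apply/idP/idP; first exact: half ab.
by apply: half; rewrite avoids_sym.
Qed.

Lemma avoids_connect_subset (x a b : N) : connect (avoids x) a b ->
  (val a \subset val x) = (val b \subset val x).
Proof.
case/connectP=> p; elim: p a => [|c p IHp] a /=; first by move=> _ ->.
by case/andP=> /avoids_subset-> /IHp h /h.
Qed.

Lemma avoids_parent (x z : N) : x != root -> z != root -> z != x ->
  avoids x z (laminar_parent z).
Proof.
move=> xr zr zx; rewrite /avoids /= laminar_parent_adj //=.
apply/eqP => /setP E; have := E z; rewrite !inE eqxx (negPf zx) /= => /esym/eqP zE.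
have := E x; rewrite !inE eqxx eq_sym (negPf zx) /= => /eqP xE.
have [/proper_sub h1 _] := laminar_parentP xr; have [/proper_subn] := laminar_parentP zr.
by rewrite -xE zE h1.
Qed.

Lemma laminar_component (x : N) : x != root ->
  edge_component adjL x (laminar_parent x) = [set z : N | val z \subset val x].
Proof.
move=> xr; apply/setP => z; rewrite !inE -/(avoids x).
apply/idP/idP => [/avoids_connect_subset <-//|].
have [n] := ubnP (rk z); elim: n z => // n IHn z zn zx.
have [->|zx'] := eqVneq z x; first exact: connect0.
have zr : z != root.
  apply: contraNneq xr => zr; apply/eqP/val_inj/eqP.
  by rewrite eqEsubset -{2}zr zx andbT; have [] := laminar_nodeP x.
apply: connect_trans (IHn (laminar_parent z) _ _) _.
- exact: leq_trans (laminar_rk zr) zn.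
- have [_ ->//] := laminar_parentP zr.
  by rewrite properEneq zx andbT; apply: contraNneq zx' => /val_inj->.
- by apply: connect1; rewrite avoids_sym; apply: avoids_parent.
Qed.

(** Climbing from a node not contained in [x] never uses the deleted edge, so all such nodes are
    joined through the root. *)
Lemma laminar_component_parent (x : N) : x != root ->
  edge_component adjL (laminar_parent x) x = [set z : N | ~~ (val z \subset val x)].
Proof.
move=> xr; apply/setP => z; rewrite !inE setUC -/(avoids x).
have px : ~~ (val (laminar_parent x) \subset val x).
  by have [/proper_subn] := laminar_parentP xr.
apply/idP/idP => [/avoids_connect_subset <-//|].
have to_root (y : N) : ~~ (val y \subset val x) -> connect (avoids x) y root.
  have [n] := ubnP (rk y); elim: n y => // n IHn y yn yx.
  have [->|yr] := eqVneq y root; first exact: connect0.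
  have xy : y != x by apply: contraNneq yx => ->.
  have ay := avoids_parent xr yr xy.
  apply: connect_trans (connect1 ay) (IHn _ _ _).
    exact: leq_trans (laminar_rk yr) yn.
  by rewrite -(avoids_subset ay).
move=> zx; apply: connect_trans (to_root _ px) _.
by rewrite (sym_connect_sym (avoids_sym x)); apply: to_root.
Qed.

Variable a0 : A.

Definition laminar_label (x : N) : A := odflt a0 [pick a in val x].

Lemma laminar_labelP (x : N) : #|val x| = 1%N -> val x = [set laminar_label x].
Proof.
move=> /eqP/cards1P[a xE]; rewrite /laminar_label; case: pickP => [b|/(_ a)] /=.
  by rewrite xE inE => /eqP->.
by rewrite xE set11.
Qed.

Lemma laminar_label_inj : {in leaves adjL &, injective laminar_label}.
Proof.
move=> x y; rewrite !laminar_leaf => /eqP/laminar_labelP xE /eqP/laminar_labelP yE E.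
by apply: val_inj; rewrite xE E -yE.
Qed.

(** Leaves are singletons, so a part of the tree is tested on these only; this serves for the whole
    tree and for both sides of an edge. *)
Lemma laminar_label_image (Q : pred A) (S : {set N}) :
    (forall z a, val z = [set a] -> a \in F -> (z \in S) = Q a) ->
  [set laminar_label z | z in leaves adjL :&: S] = [set a in F | Q a].
Proof.
move=> SQ; apply/setP => a; rewrite inE; apply/imsetP/andP => [[z]|[aF Qa]].
  rewrite inE laminar_leaf => /andP[/eqP/laminar_labelP zE zS] ->.
  have [_ zF _] := laminar_nodeP z; rewrite zE sub1set in zF.
  by rewrite zF -(SQ z).
have aL : [set a] \in L by case: lamL => _ _ _ /(_ a aF).
pose z : N := exist _ [set a] aL.
have z1 : #|val z| = 1%N by rewrite cards1.
exists z; first by rewrite inE laminar_leaf z1 eqxx /= (SQ z a).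
by apply: set1_inj; rewrite -laminar_labelP.
Qed.

Lemma laminar_label_onto : [set laminar_label z | z in leaves adjL] = F.
Proof.
have := @laminar_label_image xpredT setT; rewrite setIT => ->.
  by apply/setP => a; rewrite inE andbT.
by move=> z a _ _; rewrite inE.
Qed.

Lemma laminar_cut (x y : N) : adjL x y -> exists2 G, P G /\ G \subset F &
  [set laminar_label z | z in leaves adjL :&: edge_component adjL x y] = G \/
  [set laminar_label z | z in leaves adjL :&: edge_component adjL x y] = F :\: G.
Proof.
have nodeP (z : N) : P (val z) /\ val z \subset F by have [] := laminar_nodeP z.
case/laminar_adjP=> -[r <-].
  exists (val x); first exact: nodeP.
  left; rewrite laminar_component // (@laminar_label_image [in val x]).
    by apply/setP => a; rewrite inE andb_idl //; have [_ /subsetP h _] := laminar_nodeP x; apply: h.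
  by move=> z a zE _; rewrite inE zE sub1set.
exists (val y); first exact: nodeP.
right; rewrite laminar_component_parent // (@laminar_label_image [predC val y]).
  by apply/setP => a; rewrite !inE andbC.
by move=> z a zE _; rewrite inE zE sub1set.
Qed.

End LaminarTree.

(** One side of a tree edge is a member of [L] and the other its complement, which has the same
    boundary. *)
Lemma laminar_branch_decomposition (H : hypergraph) (P : pred {set {set H}})
    (L : {set {set {set H}}}) :
    binary_laminar P (edges H) L -> (1 < #|edges H|)%N ->
  exists D : branch_decomposition H, forall x y : D, adj x y ->
    exists2 G, P G & boundary (cut_side x y) = boundary G.
Proof.
move=> lamL E1.
have deg x : (degree (@adj (laminar_tree lamL)) x <= 3)%N.
  have [x1|x1] := eqVneq #|val x| 1%N; first by rewrite laminar_degree1.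
  by have /andP[] := laminar_degree lamL x1.
exists (BranchDecomposition deg (@laminar_label_inj _ _ _ _ lamL E1 set0)
  (@laminar_label_onto _ _ _ _ lamL E1 set0)) => x y xy.
have [G [PG GE] cut] := laminar_cut E1 set0 xy.
exists G => //; rewrite /cut_side; case: cut => ->; rewrite ?boundaryC //.
Qed.

(** * Simple paths through a node of a tree *)

Section LeafPaths.
Variable T : tree.
Implicit Types u x y z : T.

Definition on_path u x y : Prop := exists p : seq T,
  [/\ path (@adj T) x p, uniq (x :: p), last x p = y & u \in x :: p].

Local Notation off u := [rel x y : T | [&& adj x y, x != u & y != u]].

Lemma off_sym u : symmetric (off u).
Proof. by move=> x y; rewrite /= adj_sym [(x != u) && _]andbC. Qed.

Lemma path_off u x (p : seq T) : path (@adj T) x p -> u \notin x :: p ->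
  connect (off u) x (last x p).
Proof.
move=> xp; rewrite inE negb_or => /andP[ux up].
apply/connectP; exists p => //.
elim: p x ux xp up => //= y p IHp x ux /andP[xy yp].
rewrite inE negb_or => /andP[uy up].
by rewrite xy eq_sym ux eq_sym uy IHp.
Qed.

Lemma off_component u y z :
  connect (off u) y z -> z \in edge_component (@adj T) y u.
Proof.
rewrite inE; apply: connect_sub => a b /and3P[ab au bu]; apply: connect1.
rewrite /= ab; apply/eqP => /setP/(_ u).
by rewrite !inE eqxx orbT eq_sym (negPf au) eq_sym (negPf bu).
Qed.

(** Otherwise [x] would reach [z], then [y], then [u], without using the edge between [x] and [u],
    which is a bridge. *)
Lemma off_notin_component u x y z : adj u x -> adj u y -> x != y ->
  connect (off u) y z -> z \notin edge_component (@adj T) x u.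
Proof.
move=> ux uy xy yz; apply/negP; rewrite inE => xz.
have xu : adj x u by rewrite adj_sym.
have := edge_bridge xu; rewrite inE => /negP[].
apply: connect_trans xz _; apply: (@connect_trans _ _ y); last first.
  apply: connect1; rewrite /= adj_sym uy; apply/eqP => /setP/(_ y).
  rewrite !inE eqxx [y == x]eq_sym (negPf xy) /= => /esym/eqP yu.
  by rewrite yu adj_irr in uy.
rewrite (sym_connect_sym (@off_sym u)) in yz.
apply: connect_sub yz => a b /and3P[ab au bu]; apply: connect1.
rewrite /= ab; apply/eqP => /setP/(_ u).
by rewrite !inE eqxx orbT eq_sym (negPf au) eq_sym (negPf bu).
Qed.

(** The witnesses are the predecessor and the successor of [u] on the path, distinct because the
    path is simple. *)
Lemma on_path_interior u x y : on_path u x y -> u != x -> u != y ->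
  exists x1 y1, [/\ adj u x1, adj u y1, x1 != y1,
                    connect (off u) x1 x & connect (off u) y1 y].
Proof.
case=> p [xp up yE]; rewrite inE => /predU1P[->|uinp]; first by rewrite eqxx.
case/splitPr: uinp xp up yE => p1 [|y1 p2].
  by rewrite last_cat /= => _ _ -> _; rewrite eqxx.
rewrite cat_path last_cat -cat_cons cat_uniq => /and4P[xp1 lu uy1 y1p2].
case/and3P=> _ /hasPn dis /andP[uyp _] yE ux uy.
exists (last x p1), y1; split=> //.
- by rewrite adj_sym.
- apply/eqP => E; have /dis : y1 \in u :: y1 :: p2 by rewrite !inE eqxx orbT.
  by rewrite -E mem_last.
- rewrite (sym_connect_sym (@off_sym u)); apply: path_off => //.
  by apply: dis; rewrite mem_head.
- by rewrite -yE; apply: path_off.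
Qed.

Lemma on_path_leaf u x y : on_path u x y -> u \in leaves (@adj T) ->
  u = x \/ u = y.
Proof.
move=> h; rewrite inE => /cards1P[a aE].
have [->|ux] := eqVneq u x; first by left.
have [->|uy] := eqVneq u y; first by right.
have [x1 [y1 [ux1 uy1 x1y1 _ _]]] := on_path_interior h ux uy.
have : x1 \in [set z | adj u z] by rewrite inE.
have : y1 \in [set z | adj u z] by rewrite inE.
by rewrite aE !inE => /eqP yE /eqP xE; rewrite xE yE eqxx in x1y1.
Qed.

Lemma on_path_refl x : on_path x x x.
Proof. by exists [::]; rewrite mem_head. Qed.

Lemma on_path_exists x y : on_path y x y.
Proof.
have /connectP[p xp ->] := @tree_connected T x y (in_setT x) (in_setT y).
case: (shortenP xp) => q xq uq _; exists q; split=> //; last exact: mem_last.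
by apply: sub_path xq => a b /andP[].
Qed.

Lemma on_path_connect (S : {set T}) u x y :
    on_path u x y -> (forall w, on_path w x y -> w \in S) ->
  connect [rel a b | [&& adj a b, a \in S & b \in S]] x u.
Proof.
case=> p [xp up yE uinp] pS.
have {}pS : {subset x :: p <= S} by move=> w wp; apply: pS; exists p.
apply: (path_connect (p := p)) => //.
elim: p x xp pS {up yE uinp} => //= a p IHp x /andP[xa ap] pS.
rewrite xa !pS ?mem_head ?inE ?eqxx ?orbT //= IHp //.
by move=> w wp; apply: pS; rewrite inE wp orbT.
Qed.

End LeafPaths.

(** * From a branch decomposition to a tree decomposition *)

Section BranchToTree.
Variables (H : hypergraph) (D : branch_decomposition H).

(** For fixed [v], these nodes [u] form the subtree spanned by the leaves whose hyperedges contain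
    [v]. The case [z1 = z2] covers a vertex lying in only one hyperedge. *)
Definition hull (u : D) : {set H} := [set v | `[< exists z1 z2 : D,
  [/\ z1 \in leaves (@adj D), z2 \in leaves (@adj D), v \in leaf_edge z1,
      v \in leaf_edge z2 & on_path u z1 z2] >]].

Lemma hullP (u : D) (v : H) : reflect (exists z1 z2 : D,
  [/\ z1 \in leaves (@adj D), z2 \in leaves (@adj D), v \in leaf_edge z1,
      v \in leaf_edge z2 & on_path u z1 z2]) (v \in hull u).
Proof. by rewrite inE; apply: asboolP. Qed.

Lemma leaf_of_edge (e : {set H}) : e \in edges H ->
  exists2 z : D, z \in leaves (@adj D) & leaf_edge z = e.
Proof. by rewrite -(leaf_edge_onto D) => /imsetP[z zl ->]; exists z. Qed.

Lemma leaf_edge_hull (z : D) : z \in leaves (@adj D) -> leaf_edge z \subset hull z.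
Proof.
move=> zl; apply/subsetP => v vz; apply/hullP; exists z, z.
by split=> //; apply: on_path_refl.
Qed.

Lemma hull_leaf (u : D) : u \in leaves (@adj D) -> hull u \subset leaf_edge u.
Proof.
move=> ul; apply/subsetP => v /hullP[z1 [z2 [_ _ v1 v2 /on_path_leaf/(_ ul)]]].
by case=> ->.
Qed.

Lemma hull_edge (e : {set H}) : e \in edges H -> exists u, e \subset hull u.
Proof. by case/leaf_of_edge=> z zl <-; exists z; apply: leaf_edge_hull. Qed.

Lemma hull_vertex (v : H) : exists u, v \in hull u.
Proof.
have [e /hull_edge[u /subsetP eu] ve] := no_isolated_vertex v.
by exists u; apply: eu.
Qed.

(** Each node of the set reaches a leaf containing [v] along its defining path, and any two such
    leaves are joined by a path inside the set. *)
Lemma hull_connected (v : H) : connected_in (@adj D) [set u | v \in hull u].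
Proof.
set S := [set u | _]; move=> x y.
have leafS (z : D) : z \in S ->
  exists z1, [/\ z1 \in leaves (@adj D), v \in leaf_edge z1
    & connect [rel a b | [&& adj a b, a \in S & b \in S]] z1 z].
  rewrite inE => /hullP[z1 [z2 [l1 l2 v1 v2 h]]]; exists z1; split=> //.
  apply: on_path_connect h _ => w hw; rewrite inE.
  by apply/hullP; exists z1, z2.
move=> /leafS[z1 [l1 v1 h1]] /leafS[z2 [l2 v2 h2]].
have con_sym : symmetric [rel a b : bd_tree D | [&& adj a b, a \in S & b \in S]].
  by move=> a b; rewrite /= adj_sym [(a \in S) && _]andbC.
rewrite (sym_connect_sym con_sym) in h1.
apply: connect_trans h1 _; apply: connect_trans _ h2.
apply: on_path_connect (on_path_exists z1 z2) _ => w hw.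
by rewrite inE; apply/hullP; exists z1, z2.
Qed.

Definition hull_decomposition : tree_decomposition H :=
  TreeDecomposition hull_edge hull_vertex hull_connected.

(** The path between the two leaves passes [u] through distinct neighbours [y1] and [y2]; each of
    the two edges at [u] separates the leaves, both of whose hyperedges contain [v]. *)
Lemma hull_two_boundaries (u : D) (v : H) :
    u \notin leaves (@adj D) -> v \in hull u ->
  exists y1 y2, [/\ adj u y1, adj u y2, y1 != y2,
    v \in boundary (cut_side y1 u) & v \in boundary (cut_side y2 u)].
Proof.
move=> ul /hullP[z1 [z2 [l1 l2 v1 v2 h]]].
have [y1 [y2 [uy1 uy2 y12 h1 h2]]] := on_path_interior h
  (memPnC ul _ l1) (memPnC ul _ l2).
have main (a b x y : D) : x \in leaves (@adj D) -> y \in leaves (@adj D) ->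
    v \in leaf_edge x -> v \in leaf_edge y -> x \in edge_component (@adj D) a u ->
    y \notin edge_component (@adj D) a u -> v \in boundary (cut_side a u).
  move=> xl yl vx vy xC yC; apply/boundaryP; split.
    by exists (leaf_edge x) => //; apply: imset_f; rewrite inE xl.
  exists (leaf_edge y) => //; rewrite -(leaf_edge_onto D) imset_f //=.
  apply/imsetP => -[z /setIP[zl zC] /(leaf_edge_inj yl zl) E].
  by rewrite E zC in yC.
exists y1, y2; split=> //.
- apply: (main y1 y2 z1 z2) => //; first exact: off_component.
  exact: off_notin_component h2.
- apply: (main y2 y1 z2 z1) => //; first exact: off_component.
  by apply: off_notin_component h1; rewrite // eq_sym.
Qed.

End BranchToTree.

(** * The factor three halves from submodularity *)

Section ThreeHalves.
Variables (R : realType) (H : hypergraph) (b : {set H} -> R).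
Hypothesis b_norm : normalised b.
Hypothesis b_mono : monotone b.
Hypothesis b_sub : submodular b.

(** Submodularity is applied to [A1], [A2] and then to [A1 :&: A2], [A3]; the leftover triple
    intersection has nonnegative value. The two inclusions hold when each element of [X] lies in two
    of the sets. *)
Lemma submodular_three (X A1 A2 A3 : {set H}) :
    X \subset A1 :|: A2 -> X \subset (A1 :&: A2) :|: A3 ->
  2 * b X <= b A1 + b A2 + b A3.
Proof.
move=> /b_mono X12 /b_mono X3.
have := b_sub A1 A2; have := b_sub (A1 :&: A2) A3.
have := b_mono (sub0set (A1 :&: A2 :&: A3)); rewrite b_norm.
by lra.
Qed.

Lemma submodular_cover (T : finType) (N : {set T}) (A : T -> {set H})
    (X : {set H}) (k : R) :
    (#|N| <= 3)%N -> 0 <= k -> {in N, forall y, b (A y) <= k} ->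
    {in X, forall v, exists y1 y2,
      [/\ y1 \in N, y2 \in N, y1 != y2, v \in A y1 & v \in A y2]} ->
  b X <= 3 / 2 * k.
Proof.
move=> N3 k0 Ak X2.
have [->|/set0Pn[v0 /X2[y1 [y2 [y1N y2N y12 _ _]]]]] := eqVneq X set0.
  by rewrite b_norm mulr_ge0 // divr_ge0.
(* At most one index remains, so [A3] is the third set, or empty when there are only two. *)
pose N' := N :\ y1 :\ y2; pose A3 := \bigcup_(y in N') A y.
have N'1 : (#|N'| <= 1)%N.
  move: N3; rewrite (cardsD1 y1) y1N (cardsD1 y2) !inE eq_sym y12 y2N.
  by rewrite -/N' !add1n !ltnS.
have A3k : b A3 <= k.
  have [N0|/set0Pn[y yN]] := eqVneq N' set0.
    by rewrite /A3 N0 big_set0 b_norm.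
  have NE : N' = [set y].
    by apply/esym/eqP; rewrite eqEcard sub1set yN cards1.
  rewrite /A3 NE big_set1; apply: Ak.
  by move: yN; rewrite !inE => /and3P[].
have inN y : y \in N -> [\/ y = y1, y = y2 | y \in N'].
  move=> yN; have [->|n1] := eqVneq y y1; first by constructor 1.
  have [->|n2] := eqVneq y y2; first by constructor 2.
  by constructor 3; rewrite !inE n1 n2.
have N'eq y z : y \in N' -> z \in N' -> y = z.
  by move=> yN zN; apply/eqP; apply: contraTT N'1 => yz;
     rewrite -ltnNge; apply/card_gt1P; exists y, z.
have inA3 y v : y \in N' -> v \in A y -> v \in A3.
  by move=> yN vy; apply/bigcupP; exists y.
have h1 : X \subset A y1 :|: A y2.
  apply/subsetP => v /X2[y [z [/inN yN /inN zN yz vy vz]]]; rewrite inE.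
  case: yN => [<-|<-|yN]; rewrite ?vy ?orbT //.
  case: zN => [<-|<-|zN]; rewrite ?vz ?orbT //.
  by rewrite (N'eq y z) ?eqxx in yz.
have h2 : X \subset (A y1 :&: A y2) :|: A3.
  apply/subsetP => v /X2[y [z [/inN yN /inN zN yz vy vz]]]; rewrite !inE.
  case: yN yz vy => [->|->|yN] yz vy; last by rewrite (inA3 _ _ yN vy) orbT.
  - case: zN yz vz => [->|->|zN] yz vz; last by rewrite (inA3 _ _ zN vz) orbT.
      by rewrite eqxx in yz.
    by rewrite vy vz.
  - case: zN yz vz => [->|->|zN] yz vz; last by rewrite (inA3 _ _ zN vz) orbT.
      by rewrite vy vz.
    by rewrite eqxx in yz.
have := submodular_three h1 h2; have := Ak _ y1N; have := Ak _ y2N.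
by move: A3k; lra.
Qed.

Lemma hull_le (D : branch_decomposition H) (k : R) (u : D) :
    edge_dominated b -> 0 <= k ->
    (forall x y : D, adj x y -> boundary_lift b (cut_side x y) <= k) ->
  b (hull u) <= Num.max 1 (3 / 2 * k).
Proof.
move=> b_dom k0 Dk; rewrite le_max.
have [ul|ul] := boolP (u \in leaves (@adj D)).
  have eE : leaf_edge u \in edges H by rewrite -(leaf_edge_onto D) imset_f.
  by rewrite (b_dom _ _ eE (hull_leaf ul)).
apply/orP; right.
apply: (@submodular_cover D [set y | adj u y] (fun y => boundary (cut_side y u))) => //.
- exact: bd_subcubic.
- by move=> y; rewrite inE adj_sym; apply: Dk.
- move=> v /(hull_two_boundaries ul)[y1 [y2 [uy1 uy2 y12 v1 v2]]].
  by exists y1, y2; split; rewrite // inE.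
Qed.

End ThreeHalves.

(** * The tree decomposition with a single bag *)

Section TrivialTree.
Variable H : hypergraph.

Let no_edge : rel unit := fun _ _ => false.

Lemma unit_sym : symmetric no_edge. Proof. by []. Qed.

Lemma unit_irr : irreflexive no_edge. Proof. by []. Qed.

Lemma unit_nonempty : (0 < #|{: unit}|)%N. Proof. by rewrite card_unit. Qed.

Lemma unit_connected (A : {set unit}) : connected_in no_edge A.
Proof. by move=> [] [] _ _; apply: connect0. Qed.

Lemma unit_acyclic : acyclic no_edge.
Proof. by move=> c /andP[_ /card_uniqP <-]; rewrite (leq_trans (max_card _)) ?card_unit. Qed.

Definition unit_tree : tree :=
  Tree unit_sym unit_irr unit_nonempty (@unit_connected setT) unit_acyclic.

Definition unit_decomposition : tree_decomposition H.
Proof.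
apply: (@TreeDecomposition H unit_tree (fun=> setT)) => [e _|v|v].
- by exists tt; apply: subsetT.
- by exists tt; rewrite inE.
- exact: unit_connected.
Defined.

End TrivialTree.

(** * Comparison of the widths, first for each [b], then for suprema *)

Section Widths.
Variables (R : realType) (H : hypergraph).
Implicit Types (b : {set H} -> R) (C : set ({set H} -> R)).

Lemma tau_le b (k : R) (D : tree_decomposition H) :
  0 <= k -> (forall u : D, b (bag u) <= k) -> tau b <= k.
Proof.
move=> k0 bk; apply: (@le_trans _ _ (\big[Num.max/0]_(u : D) b (bag u))).
  apply: ge_inf; last by exists D.
  by exists 0 => _ [D' ->]; apply: bigmax_ge_id.
by apply: bigmax_le.
Qed.

Lemma branch_width_le b (k : R) (D : branch_decomposition H) :
    0 <= k -> (forall x y : D, adj x y -> boundary_lift b (cut_side x y) <= k) ->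
  branch_width (boundary_lift b) <= k.
Proof.
move=> k0 bk; rewrite /branch_width; case: ifP => // _.
apply: (@le_trans _ _ (\big[Num.max/0]_(f : D * D | adj f.1 f.2)
    boundary_lift b (cut_side f.1 f.2))).
  apply: ge_inf; last by exists D.
  by exists 0 => _ [D' ->]; apply: bigmax_ge_id.
by apply: bigmax_le => // f; apply: bk.
Qed.

Lemma branch_decomposition_of_tree b (D : tree_decomposition H) :
    monotone b -> (1 < #|edges H|)%N ->
  exists D' : branch_decomposition H, forall x y : D', adj x y ->
    boundary_lift b (cut_side x y) <= \big[Num.max/0]_(u : D) b (bag u).
Proof.
move=> b_mono E1; case: (tree_decomposition_laminar D) => [E0|[L lamL]].
  by rewrite E0 cards0 in E1.
have [D' cutD'] := laminar_branch_decomposition lamL E1; exists D' => x y.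
case/cutD' => G /existsP[u Gu] E; rewrite /boundary_lift E.
by apply: le_trans (b_mono _ _ Gu) _; apply: (le_bigmax 0 (fun u : D => b (bag u))).
Qed.

Lemma branch_width_le_tau b : monotone b -> branch_width (boundary_lift b) <= tau b.
Proof.
move=> b_mono; apply: lb_le_inf => [|_ [D ->]].
  by eexists; exists (unit_decomposition H).
have k0 : 0 <= \big[Num.max/0]_(u : D) b (bag u) by apply: bigmax_ge_id.
have [E1|E1] := leqP #|edges H| 1; first by rewrite /branch_width E1.
have [D' cutD'] := branch_decomposition_of_tree D b_mono E1.
exact: branch_width_le cutD'.
Qed.

Lemma tau_le_branch_width b : oneSub b ->
  tau b <= Num.max 1 (3 / 2 * branch_width (boundary_lift b)).
Proof.
case=> b0 b_norm b_mono b_sub b_dom; rewrite /branch_width.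
(* Here the branch width is 0 by convention, but the single bag, if nonempty, is itself the
   hyperedge, so the bound 1 suffices. *)
have [E1|E1] := leqP #|edges H| 1.
  apply: (@tau_le b _ (unit_decomposition H)) => [|u]; rewrite le_max ?ler01 //.
  apply/orP; left; rewrite /bag /=.
  have [E0|/set0Pn[e eE]] := eqVneq (edges H) set0.
    suff -> : [set: H] = set0 by rewrite b_norm ler01.
    apply/setP => v; rewrite !inE; apply/idP.
    by have [e] := no_isolated_vertex v; rewrite E0 inE.
  apply: (b_dom e) => //; apply/subsetP => v _.
  have [e' e'E ve'] := no_isolated_vertex v.
  by rewrite (card_le1_eqP E1 e' e).
(* Once [tau b] exceeds 1 the maximum must come from its second term, and the claim becomes a lower
   bound on the infimum, checked for each decomposition. *)
have [t1|t1] := leP (tau b) 1; first by rewrite le_max t1.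
rewrite le_max [X in _ || X](_ : _ = true) ?orbT //.
suff : 2 / 3 * tau b <= inf [set r | exists D : branch_decomposition H,
    r = \big[Num.max/0]_(f : D * D | adj f.1 f.2)
      boundary_lift b (cut_side f.1 f.2)]%classic by lra.
apply: lb_le_inf => [|_ [D ->]].
  have [D _] := branch_decomposition_of_tree (unit_decomposition H) b_mono E1.
  by eexists; exists D.
set k := \big[_/_]_(_ | _) _.
have k0 : 0 <= k by apply: bigmax_ge_id.
have : tau b <= Num.max 1 (3 / 2 * k).
  apply: (@tau_le b _ (hull_decomposition D)) => [|u]; first by rewrite le_max ler01.
  apply: hull_le => // x y xy.
  exact: (le_bigmax_cond 0 (fun f : D * D => boundary_lift b (cut_side f.1 f.2))
            (j := (x, y))).
by rewrite le_max leNgt t1 /=; lra.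
Qed.

(** Subadditivity over the hyperedges bounds the value of the single bag; this bound, uniform in
    [b], makes the suprema meaningful. *)
Lemma tau_le_card b : oneSub b -> tau b <= #|edges H|%:R.
Proof.
case=> b0 b_norm b_mono b_sub b_dom.
apply: (@tau_le b _ (unit_decomposition H)) => // u.
have -> : bag u = cover (edges H).
  apply/setP => v; rewrite inE; apply/esym/bigcupP.
  by have [e] := no_isolated_vertex v; exists e.
rewrite /cover -sum1_card natr_sum.
apply: (@le_trans _ _ (\sum_(e in edges H) b e)); last first.
  by apply: ler_sum => e eE; apply: b_dom eE (subxx e).
elim/big_rec2: _ => [|e X s _ IH]; first by rewrite b_norm.
have := b_sub e s; have := b0 (e :&: s); move: IH; lra.
Qed.

(** Stated for any nonempty class of admissible functions, so that the submodular and the modular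
    case are both instances. *)
Lemma lift_comparison C : (C `<=` @oneSub R H)%classic -> (C !=set0)%classic ->
  sup [set branch_width (boundary_lift b) | b in C]%classic <=
    sup [set tau b | b in C]%classic <=
    Num.max 1 (3 / 2 * sup [set branch_width (boundary_lift b) | b in C]%classic).
Proof.
move=> CS [b1 Cb1].
have bw_tau b : C b -> branch_width (boundary_lift b) <= tau b.
  by move=> /CS[_ _ b_mono _ _]; apply: branch_width_le_tau.
have tau_card b : C b -> tau b <= #|edges H|%:R by move=> /CS; apply: tau_le_card.
have ub_tau : has_ubound [set tau b | b in C]%classic.
  by exists #|edges H|%:R => _ [b Cb <-]; apply: tau_card.
have ub_bw : has_ubound [set branch_width (boundary_lift b) | b in C]%classic.
  exists #|edges H|%:R => _ [b Cb <-].
  by apply: le_trans (bw_tau _ Cb) (tau_card _ Cb).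
apply/andP; split; (apply: ge_sup; first by eexists; exists b1) => _ [b Cb <-].
  by apply: le_trans (bw_tau _ Cb) _; apply: ub_le_sup => //; exists b.
apply: le_trans (tau_le_branch_width (CS _ Cb)) _.
rewrite ge_max le_max lexx /= le_max ler_pM2l ?divr_gt0 // ub_le_sup ?orbT //.
by exists b.
Qed.

Lemma modular_submodular b : modular b -> submodular b.
Proof.
case=> w _ bE X Y; rewrite !bE.
rewrite 4![\sum_(v in _) w v]big_mkcond -!big_split /= le_eqVlt.
apply/orP; left; apply/eqP; apply: eq_bigr => v _; rewrite !inE.
by case: (v \in X); case: (v \in Y); rewrite ?addr0 ?add0r.
Qed.

Lemma oneMod_sub : (@oneMod R H `<=` @oneSub R H)%classic.
Proof. by move=> b [b0 bn bm /modular_submodular bs bd]. Qed.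

Lemma zero_oneMod : @oneMod R H (fun=> 0).
Proof.
split=> [X|//|X Y _||e X _ _]; rewrite ?lexx ?ler01 //.
by exists (fun=> 0) => // X; rewrite big1.
Qed.

End Widths.

Theorem corollary3p5 (R : realType) (H : hypergraph) :
  (subw_lift R H <= subw R H <= Num.max 1 (3 / 2 * subw_lift R H)) /\
  (adw_lift R H <= adw R H <= Num.max 1 (3 / 2 * adw_lift R H)).
Proof.
split; apply: lift_comparison; last 1 first.
- by exists (fun=> 0); apply: zero_oneMod.
- by [].
- by exists (fun=> 0); apply/oneMod_sub/zero_oneMod.
- exact: oneMod_sub.
Qed.
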